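(* Let $X$ be a pointed metric space and $E$ a Banach space over $\mathbb{K}$. Then $\pi$ is the greatest Lipschitz cross-norm on $X\boxtimes E$; that is, $\pi$ is a Lipschitz cross-norm on $X\boxtimes E$, and $\alpha(u)\leq\pi(u)$ for every Lipschitz cross-norm $\alpha$ on $X\boxtimes E$ and every $u\in X\boxtimes E$.
   Context: $\mathbb{K}$ is $\mathbb{R}$ or $\mathbb{C}$. A pointed metric space $X$ is a metric space (with metric $d$) with a distinguished base point $0$. For a pointed metric space $X$ and a Banach space $F$, $\mathrm{Lip}_0(X,F)$ is the vector space of all Lipschitz maps $f\colon X\to F$ with $f(0)=0$. $E^*$ is the topological dual of $E$ and $\langle\phi,e\rangle=\phi(e)$; $V'$ denotes the algebraic dual of a vector space $V$. For $x,y\in X$ and $e\in E$, $\delta_{(x,y)}\boxtimes e\in \mathrm{Lip}_0(X,E^* )'$ is the linear functional $f\mapsto\langle f(x)-f(y),e\rangle$. The Lipschitz tensor product $X\boxtimes E$ is the linear subspace of $\mathrm{Lip}_0(X,E^* )'$ spanned by all the functionals $\delta_{(x,y)}\boxtimes e$ with $x,y\in X$, $e\in E$. Every $u\in X\boxtimes E$ can be written (non-uniquely) as $u=\sum_{i=1}^n\delta_{(x_i,y_i)}\boxtimes e_i$. For $u\in X\boxtimes E$, the Lipschitz projective norm is $$\pi(u)=\inf\left\{\sum_{i=1}^n d(x_i,y_i)\|e_i\|\colon u=\sum_{i=1}^n\delta_{(x_i,y_i)}\boxtimes e_i\right\},$$ the infimum being over all representations of $u$. A norm $\alpha$ on $X\boxtimes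 E$ is a Lipschitz cross-norm if $\alpha(\delta_{(x,y)}\boxtimes e)=d(x,y)\|e\|$ for all $x,y\in X$, $e\in E$. *)

(* Defs.v *)
From HB Require Import structures.
From mathcomp Require Import all_boot all_order all_algebra.
From mathcomp Require Import all_classical all_reals all_analysis.
From mathcomp Require Import complex.

Set Implicit Arguments.
Unset Strict Implicit.
Unset Printing Implicit Defensive.

Import Order.TTheory GRing.Theory Num.Theory.
Import numFieldNormedType.Exports.

Local Open Scope classical_set_scope.
Local Open Scope ring_scope.

Inductive scalar_kind := real_scalars | complex_scalars.

Definition scalars (R : realType) (k : scalar_kind) : numFieldType :=
  match k with real_scalars => R : numFieldType
             | complex_scalars => R[i]%C : numFieldType end.

(* Norms of a [normedModType K] take values in [K]; over the complex numbers
   they are real elements of [R[i]].  [scalar_re] reads them in [R]. *)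
Definition scalar_re (R : realType) (k : scalar_kind) : scalars R k -> R :=
  match k with real_scalars => id | complex_scalars => @complex.Re R end.

Definition scalar_inj (R : realType) (k : scalar_kind) : R -> scalars R k :=
  match k with real_scalars => id | complex_scalars => real_complex R end.

Section scalar_theory.
Context {R : realType} {k : scalar_kind}.
Notation K := (scalars R k).
Implicit Types z : K.

Lemma scalar_injK (x : R) : scalar_re (scalar_inj k x) = x.
Proof. by case: k. Qed.

Lemma scalar_reK z : 0 <= z -> scalar_inj k (scalar_re z) = z.
Proof.
case: k z => //= -[a b]; rewrite lecE /= => /andP[/eqP b0 _].
by rewrite b0.
Qed.

Lemma scalar_inj_le (x y : R) : (scalar_inj k x <= scalar_inj k y) = (x <= y).
Proof. by case: k => //=; rewrite lecR. Qed.

Lemma scalar_injD (x y : R) : scalar_inj k (x + y) = scalar_inj k x + scalar_inj k y.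
Proof. by case: k => //=; rewrite rmorphD. Qed.

Lemma scalar_injM (x y : R) : scalar_inj k (x * y) = scalar_inj k x * scalar_inj k y.
Proof. by case: k => //=; rewrite rmorphM. Qed.

Lemma scalar_inj0 : scalar_inj k (0 : R) = 0.
Proof. by case: k => //=; rewrite rmorph0. Qed.

Lemma scalar_inj1 : scalar_inj k (1 : R) = 1.
Proof. by case: k => //=; rewrite rmorph1. Qed.

End scalar_theory.
Arguments scalar_inj R k : clear implicits.

Definition sabs (R : realType) (k : scalar_kind) (z : scalars R k) : R :=
  scalar_re `|z|.

Definition rnorm (R : realType) (k : scalar_kind)
  (V : normedModType (scalars R k)) (v : V) : R := scalar_re `|v|.

Section rnorm_theory.
Context {R : realType} {k : scalar_kind} {V : normedModType (scalars R k)}.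
Notation K := (scalars R k).

Lemma rnormE (v : V) : scalar_inj R k (rnorm v) = `|v|.
Proof. exact: scalar_reK. Qed.

Lemma rnorm_ge0 (v : V) : 0 <= rnorm v.
Proof. by rewrite -(@scalar_inj_le R k) rnormE scalar_inj0. Qed.

Lemma rnorm_triangle (v w : V) : rnorm (v + w) <= rnorm v + rnorm w.
Proof. by rewrite -(@scalar_inj_le R k) scalar_injD !rnormE ler_normD. Qed.

Lemma sabsE (c : K) : scalar_inj R k (sabs c) = `|c|.
Proof. exact: scalar_reK. Qed.

Lemma rnormZ (c : K) (v : V) : rnorm (c *: v) = sabs c * rnorm v.
Proof.
by rewrite -[RHS](@scalar_injK R k) scalar_injM sabsE rnormE -normrZ.
Qed.

Lemma sabs_ge0 (c : K) : 0 <= sabs c.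
Proof. by rewrite -(@scalar_inj_le R k) sabsE scalar_inj0. Qed.

Lemma sabsM (c d : K) : sabs (c * d) = sabs c * sabs d.
Proof. by rewrite -[RHS](@scalar_injK R k) scalar_injM !sabsE -normrM. Qed.

Lemma sabs_inj (x : R) : 0 <= x -> sabs (scalar_inj R k x) = x.
Proof.
move=> x0; rewrite /sabs ger0_norm ?scalar_injK//.
by rewrite -scalar_inj0 scalar_inj_le.
Qed.

Lemma sabs1 : sabs (1 : K) = 1.
Proof. by rewrite -scalar_inj1 sabs_inj. Qed.

Lemma sabs_eq0 (c : K) : sabs c = 0 -> c = 0.
Proof. by move=> c0; apply: normr0_eq0; rewrite -sabsE c0 scalar_inj0. Qed.

Lemma rnorm0 : rnorm (0 : V) = 0.
Proof. by rewrite -[LHS](@scalar_injK R k) rnormE normr0 -scalar_inj0 scalar_injK. Qed.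

Lemma rnorm0_eq0 (v : V) : rnorm v = 0 -> v = 0.
Proof. by move=> v0; apply: normr0_eq0; rewrite -rnormE v0 scalar_inj0. Qed.

End rnorm_theory.

Section algebraic_dual.
Context {K : numFieldType}.

Definition alg_dual_pred (V : lmodType K) : {pred V -> K^o} :=
  [pred phi | `[< linear phi >]].
Arguments alg_dual_pred : clear implicits.

Lemma alg_dual_submod (V : lmodType K) : submod_closed (alg_dual_pred V).
Proof.
split.
  by rewrite inE => c u v; change (0 = c *: (0 : K^o) + 0); rewrite scaler0 addr0.
move=> c f g; rewrite !inE => fl gl.
move=> d u v; change (c *: f (d *: u + v) + g (d *: u + v) =
    d *: (c *: f u + g u) + (c *: f v + g v)); rewrite fl gl.
by rewrite !scalerDr addrACA !scalerA mulrC.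
Qed.

HB.instance Definition _ (V : lmodType K) :=
  GRing.isSubmodClosed.Build K (V -> K^o) (alg_dual_pred V)
    (@alg_dual_submod V).

Record alg_dual (V : lmodType K) := AlgDual {
  alg_dual_fun :> V -> K^o ;
  _ : alg_dual_fun \in alg_dual_pred V }.

HB.instance Definition _ (V : lmodType K) := [isSub for @alg_dual_fun V].
HB.instance Definition _ (V : lmodType K) := [Choice of alg_dual V by <:].
HB.instance Definition _ (V : lmodType K) :=
  [SubChoice_isSubLmodule of alg_dual V by <:].

End algebraic_dual.
Arguments alg_dual_pred {K} V.

Section linear_span.
Context {K : numFieldType} {V : lmodType K} (S : set V).

Definition linspan : {pred V} :=
  [pred v | `[< exists s : seq (K * V), (forall p, p \in s -> S p.2) /\
                  v = \sum_(p <- s) p.1 *: p.2 >]].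

Lemma linspan_submod : submod_closed linspan.
Proof.
split.
  by rewrite inE; exists [::]; rewrite big_nil.
move=> c u v; rewrite !inE => -[s [sS ->]] [t [tS ->]].
exists ([seq (c * p.1, p.2) | p <- s] ++ t); split.
  move=> p; rewrite mem_cat => /orP[/mapP[q qs ->]|]; last exact: tS.
  exact: (sS q).
rewrite big_cat big_map scaler_sumr; congr (_ + _).
by apply: eq_bigr => p _; rewrite scalerA.
Qed.

HB.instance Definition _ :=
  GRing.isSubmodClosed.Build K V linspan linspan_submod.

Lemma mem_linspan v : S v -> v \in linspan.
Proof.
move=> Sv; rewrite inE; exists [:: (1, v)]; split.
  by move=> p; rewrite inE => /eqP ->.
by rewrite big_seq1 scale1r.
Qed.

End linear_span.

Section topological_dual.
Context {R : realType} {k : scalar_kind}.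
Notation K := (scalars R k).

Definition dual_pred (E : normedModType K) : {pred E -> K^o} :=
  [pred phi | `[< linear phi /\ continuous phi >]].
Arguments dual_pred : clear implicits.

Lemma dual_submod (E : normedModType K) : submod_closed (dual_pred E).
Proof.
split.
  rewrite inE; split; last exact: cst_continuous.
  by move=> c u v; change (0 = c *: (0 : K^o) + 0); rewrite scaler0 addr0.
move=> c f g; rewrite !inE => -[fl fc] [gl gc].
split.
  move=> d u v; change (c *: f (d *: u + v) + g (d *: u + v) =
    d *: (c *: f u + g u) + (c *: f v + g v)); rewrite fl gl.
  by rewrite !scalerDr addrACA !scalerA mulrC.
by move=> x; apply: cvgD; [apply: cvgZr; exact: fc|exact: gc].
Qed.

HB.instance Definition _ (E : normedModType K) :=
  GRing.isSubmodClosed.Build K (E -> K^o) (dual_pred E) (@dual_submod E).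

Record top_dual (E : normedModType K) := Dual {
  dual_fun :> E -> K^o ;
  _ : dual_fun \in dual_pred E }.

HB.instance Definition _ (E : normedModType K) := [isSub for @dual_fun E].
HB.instance Definition _ (E : normedModType K) := [Choice of top_dual E by <:].
HB.instance Definition _ (E : normedModType K) :=
  [SubChoice_isSubLmodule of top_dual E by <:].

Context {E : normedModType K}.
Implicit Types phi psi : top_dual E.

Definition op_norm phi : R :=
  sup [set rnorm (phi e) | e in [set e : E | rnorm e <= 1]].

Lemma dual_linear phi : linear phi.
Proof. by case: phi => f /=; rewrite inE => -[]. Qed.

Lemma dual_continuous phi : continuous phi.
Proof. by case: phi => f /=; rewrite inE => -[]. Qed.

Lemma dual_bounded phi :
  exists M : R, forall e, rnorm (phi e) <= M * rnorm e.
Proof.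
pose f : {linear E -> K^o} :=
  HB.pack (phi : E -> K^o) (GRing.isLinear.Build _ _ _ _ _ (@dual_linear phi)).
have /linear_boundedP/pinfty_ex_gt0[M M0 fM] : bounded_near f (nbhs (0 : E)).
  by apply/linear_bounded_continuous; exact: dual_continuous.
exists (scalar_re M) => e.
rewrite -(@scalar_inj_le R k) scalar_injM !rnormE scalar_reK; last exact: ltW.
exact: (fM e).
Qed.

Lemma op_norm_has_sup phi :
  has_sup [set rnorm (phi e) | e in [set e : E | rnorm e <= 1]].
Proof.
split.
  by exists (rnorm (phi 0)), 0 => //=; rewrite rnorm0.
have [M phiM] := dual_bounded phi.
exists `|M| => _ [e /= e1 <-]; apply: (le_trans (phiM e)).
apply: (le_trans (ler_wpM2r (rnorm_ge0 e) (ler_norm M))).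
by rewrite ler_piMr.
Qed.

Lemma op_norm_ub phi e : rnorm e <= 1 -> rnorm (phi e) <= op_norm phi.
Proof.
by move=> e1; apply: (ub_le_sup (op_norm_has_sup phi).2); exists e.
Qed.

Lemma op_norm_le phi (M : R) :
  (forall e, rnorm e <= 1 -> rnorm (phi e) <= M) -> op_norm phi <= M.
Proof.
move=> h; apply: ge_sup; first exact: (op_norm_has_sup phi).1.
by move=> _ [e e1 <-]; exact: h.
Qed.

Lemma op_norm_ge0 phi : 0 <= op_norm phi.
Proof.
apply: (le_trans (rnorm_ge0 (phi 0))); apply: op_norm_ub.
by rewrite rnorm0.
Qed.

Lemma le_op_norm phi e : rnorm (phi e) <= op_norm phi * rnorm e.
Proof.
have l0 : phi 0 = 0.
  by have := dual_linear phi (-1) 0 0; rewrite scaler0 addr0 scaleN1r addNr.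
have lZ c (x : E) : phi (c *: x) = c *: phi x.
  by have := dual_linear phi c x 0; rewrite !addr0 l0 addr0.
have [e0|e0] := eqVneq (rnorm e) 0.
  by rewrite e0 mulr0 (rnorm0_eq0 e0) l0 rnorm0.
have ep : 0 < rnorm e by rewrite lt_neqAle eq_sym e0 rnorm_ge0.
pose c := scalar_inj R k (rnorm e)^-1.
have nc : sabs c = (rnorm e)^-1 by rewrite sabs_inj// invr_ge0 ltW.
have := @op_norm_ub phi (c *: e); rewrite lZ !rnormZ nc mulVf// => /(_ (lexx _)).
by rewrite mulrC ler_pdivrMr.
Qed.

Lemma op_normD phi psi : op_norm (phi + psi) <= op_norm phi + op_norm psi.
Proof.
apply: op_norm_le => e e1; apply: (le_trans (rnorm_triangle _ _)).
by apply: lerD; exact: op_norm_ub.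
Qed.

Lemma op_normZ (c : K) phi :
  op_norm (c *: phi) = sabs c * op_norm phi.
Proof.
have hle (d : K) psi : op_norm (d *: psi) <= sabs d * op_norm psi.
  apply: op_norm_le => e e1; rewrite [X in X <= _]rnormZ.
  by apply: ler_wpM2l; [exact: rnorm_ge0|exact: op_norm_ub].
apply/le_anti/andP; split; first exact: hle.
have [->|c0] := eqVneq c 0.
  by rewrite -scalar_inj0 sabs_inj// mul0r op_norm_ge0.
have cp : 0 < sabs c.
  rewrite lt_neqAle sabs_ge0 andbT eq_sym.
  by apply: contra_neq c0; exact: sabs_eq0.
have := hle c^-1 (c *: phi); rewrite scalerA mulVf// scale1r.
by rewrite -(ler_pM2l cp) mulrA -sabsM mulfV// sabs1 mul1r.
Qed.

Lemma op_norm0_eq0 phi : op_norm phi = 0 -> phi = 0.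
Proof.
move=> phi0; apply/val_inj/funext => e.
apply: (@rnorm0_eq0 _ _ K^o); apply/le_anti; rewrite rnorm_ge0 andbT.
by apply: (le_trans (le_op_norm phi e)); rewrite phi0 mul0r.
Qed.

Let dual_norm phi : K := scalar_inj R k (op_norm phi).

Let dual_normD phi psi : dual_norm (phi + psi) <= dual_norm phi + dual_norm psi.
Proof. by rewrite -scalar_injD scalar_inj_le op_normD. Qed.

Let dual_normZ (c : K) phi : dual_norm (c *: phi) = `|c| * dual_norm phi.
Proof. by rewrite /dual_norm op_normZ scalar_injM sabsE. Qed.

Let dual_norm0_eq0 phi : dual_norm phi = 0 -> phi = 0.
Proof.
move=> h; apply: op_norm0_eq0.
by rewrite -[LHS](@scalar_injK R k) [scalar_inj _ _ _]h -scalar_inj0 scalar_injK.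
Qed.

HB.instance Definition _ := @Lmodule_isNormed.Build K (top_dual E) dual_norm
  dual_normD dual_normZ dual_norm0_eq0.

Lemma rnorm_dualE phi : rnorm phi = op_norm phi.
Proof. exact: scalar_injK. Qed.

End topological_dual.
Arguments top_dual {R k} E.

#[short(type="pointedMetricType")]
HB.structure Definition PointedMetric (K : numDomainType) :=
  { M of Metric K M & isPointed M }.

Section Lip0.
Context {R : realType} {k : scalar_kind}.
Notation K := (scalars R k).
Variables (X : pointedMetricType R) (F : normedModType K).

Definition lip_fun (f : X -> F) : Prop :=
  exists C : R, forall x y, rnorm (f x - f y) <= C * mdist x y.

Definition lip0_pred : {pred X -> F} :=
  [pred f | `[< lip_fun f /\ f point = 0 >]].

Lemma lip0_submod : submod_closed lip0_pred.
Proof.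
split.
  rewrite inE; split => //.
  by exists 0 => x y; rewrite subrr rnorm0 mul0r.
move=> c f g; rewrite !inE => -[[C fC] f0]  [[D gD] g0].
split; last by rewrite !fctE f0 g0 scaler0 addr0.
exists (sabs c * C + D) => x y.
rewrite !fctE opprD addrACA -scalerBr mulrDl -mulrA.
apply: (le_trans (rnorm_triangle _ _)); apply: lerD; last exact: gD.
by rewrite rnormZ ler_wpM2l// rnorm_ge0.
Qed.

HB.instance Definition _ :=
  GRing.isSubmodClosed.Build K (X -> F) lip0_pred lip0_submod.

Record lip0 := Lip0 { lip0_fun :> X -> F ; _ : lip0_fun \in lip0_pred }.

HB.instance Definition _ := [isSub for lip0_fun].
HB.instance Definition _ := [Choice of lip0 by <:].
HB.instance Definition _ := [SubChoice_isSubLmodule of lip0 by <:].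

End Lip0.

Section lipschitz_tensor_product.
Context {R : realType} {k : scalar_kind}.
Notation K := (scalars R k).
Context {X : pointedMetricType R} {E : completeNormedModType K}.

(* The functional delta_(x,y) box e : f |-> <f x - f y, e>; successively a bare
   function, an element of the algebraic dual, and (as [box]) an element of
   the Lipschitz tensor product. *)
Definition box_fun (x y : X) (e : E) : lip0 X (top_dual E) -> K^o :=
  fun f => (f x - f y) e.

Lemma box_fun_linear x y e : box_fun x y e \in alg_dual_pred (lip0 X (top_dual E)).
Proof.
rewrite inE => c f g; rewrite /box_fun.
have -> : (c *: f + g) x - (c *: f + g) y = c *: (f x - f y) + (g x - g y).
  rewrite [(c *: f + g) x](_ : _ = c *: f x + g x)//.
  rewrite [(c *: f + g) y](_ : _ = c *: f y + g y)//.
  by rewrite opprD addrACA scalerBr.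
by [].
Qed.

Definition box_dual (x y : X) (e : E) : alg_dual (lip0 X (top_dual E)) :=
  AlgDual (box_fun_linear x y e).

Definition boxes : set (alg_dual (lip0 X (top_dual E))) :=
  [set v | exists x y e, v = box_dual x y e].

Lemma box_dual_span x y e : box_dual x y e \in linspan boxes.
Proof. by apply: mem_linspan; exists x, y, e. Qed.

End lipschitz_tensor_product.

Section lip_tensor.
Context {R : realType} {k : scalar_kind}.
Notation K := (scalars R k).
Variables (X : pointedMetricType R) (E : completeNormedModType K).

Record lip_tensor := LipTensor {
  lip_tensor_val :> alg_dual (lip0 X (top_dual E)) ;
  _ : lip_tensor_val \in linspan boxes }.

HB.instance Definition _ := [isSub for lip_tensor_val].
HB.instance Definition _ := [Choice of lip_tensor by <:].
HB.instance Definition _ := [SubChoice_isSubLmodule of lip_tensor by <:].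

End lip_tensor.

Section cross_norms.
Context {R : realType} {k : scalar_kind}.
Notation K := (scalars R k).
Context {X : pointedMetricType R} {E : completeNormedModType K}.

Definition box (x y : X) (e : E) : lip_tensor X E :=
  LipTensor (box_dual_span x y e).

(* The empty representation ([n = 0]) is allowed; it only concerns [u = 0],
   where [box point point 0] already gives the value 0. *)
Definition lip_proj_norm (u : lip_tensor X E) : R :=
  inf [set r | exists (n : nat) (x y : 'I_n -> X) (e : 'I_n -> E),
         u = \sum_(i < n) box (x i) (y i) (e i) /\
         r = \sum_(i < n) mdist (x i) (y i) * rnorm (e i)].

Record is_norm (V : lmodType K) (alpha : V -> R) : Prop := IsNorm {
  is_norm_ge0 : forall u, 0 <= alpha u ;
  is_norm_eq0 : forall u, alpha u = 0 -> u = 0 ;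
  is_normZ : forall (c : K) u, alpha (c *: u) = sabs c * alpha u ;
  is_normD : forall u v, alpha (u + v) <= alpha u + alpha v }.

Definition lip_cross_norm (alpha : lip_tensor X E -> R) : Prop :=
  is_norm alpha /\
  forall x y e, alpha (box x y e) = mdist x y * rnorm e.

End cross_norms.

(* Main.v *)
From HB Require Import structures.
Require Import Defs.
From mathcomp Require Import all_boot all_order all_algebra.
From mathcomp Require Import all_classical all_reals all_analysis.
From mathcomp Require Import complex lra.

(** An infimum of costs of representations is bounded above by exhibiting one
    representation and below by bounding every representation.  The bounds from
    above give homogeneity (scale the vectors of a representation), the triangle
    inequality (concatenate two representations) and
    [pi (box x y e) <= mdist x y * rnorm e].  For any Lipschitz cross-norm the
    triangle inequality bounds the norm of [u] by the cost of each
    representation of [u], which is maximality.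

    The remaining bounds from below come from evaluating at Lipschitz maps: if
    [f : X -> E^*] has Lipschitz constant [C], then [|u f| <= C * pi u]
    ([lip_eval_le]).  As [u] is by construction a functional on Lipschitz maps,
    [pi u = 0] makes it vanish, so [pi] is definite.  The cross-norm identity
    needs a map of Lipschitz constant 1 for which evaluation is sharp on
    [box x y e], and this is where Hahn-Banach enters: take [phi] in the dual
    ball with [|phi e| = rnorm e] ([norming_functional]) and the map
    [z |-> (mdist z y - mdist point y) *: phi]; its increment from [y] to [x] is
    [mdist x y *: phi].

    The Hahn-Banach theorem is proved over the reals by applying Zorn's lemma to
    graphs of partial linear maps, and transferred to complex scalars by
    recovering a complex functional from its real part. *)

Set Implicit Arguments.
Unset Strict Implicit.
Unset Printing Implicit Defensive.

Import Order.TTheory GRing.Theory Num.Theory.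
Import numFieldNormedType.Exports.

Local Open Scope ring_scope.

(** * The Hahn-Banach theorem over the reals *)

Section hahn_banach.
Local Open Scope classical_set_scope.
Context {R : realType} {V : lmodType R} (p : V -> R).
Hypothesis p_subadd : forall u v, p (u + v) <= p u + p v.
Hypothesis p_homog : forall c u, 0 <= c -> p (c *: u) = c * p u.

(** Partial linear maps are encoded as sets of pairs closed under linear
    combinations: unions of chains are then plain unions, and single-valuedness
    need not be carried along, since domination implies it.  The empty set
    qualifies. *)
Definition linear_graph (G : set (V * R)) : Prop :=
  forall c z w, G z -> G w -> G (c *: z.1 + w.1, c * z.2 + w.2).

Definition dominated_graph (G : set (V * R)) : Prop :=
  forall z, G z -> z.2 <= p z.1.

Lemma graph_scale G c z : linear_graph G -> G z -> G (c *: z.1, c * z.2).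
Proof.
move=> Gl Gz; have G0 : G (0, 0).
  by have := Gl (-1) z z Gz Gz; rewrite scaleN1r mulN1r !addNr.
by have := Gl c z (0, 0) Gz G0; rewrite /= !addr0.
Qed.

(** Two values of the graph at [v] differ by a value at 0, which domination
    bounds by [p 0 = 0], with either sign. *)
Lemma graph_functional G v r s :
  linear_graph G -> dominated_graph G -> G (v, r) -> G (v, s) -> r = s.
Proof.
move=> Gl Gd.
have p0 : p 0 = 0 by rewrite -(scale0r 0) p_homog// mul0r.
suff le a b : G (v, a) -> G (v, b) -> a <= b.
  by move=> Gr Gs; apply/le_anti; rewrite !le.
move=> Ga Gb; have := Gd _ (Gl (-1) _ _ Gb Ga).
by rewrite /= scaleN1r mulN1r addNr p0 addrC subr_le0.
Qed.

(** The one-dimensional step.  A value [r] at [v] keeps the graph dominated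
    precisely when [z.2 - p (z.1 - v) <= r <= p (w.1 + v) - w.2] for all [z], [w]
    in the graph; subadditivity makes every lower bound at most every upper
    bound, so the supremum of the lower bounds is such an [r]. *)
Lemma graph_extend G v : G !=set0 -> linear_graph G -> dominated_graph G ->
  exists H : set (V * R), [/\ G `<=` H, linear_graph H, dominated_graph H &
    exists r, H (v, r)].
Proof.
move=> [z0 Gz0] Gl Gd.
pose S := [set z.2 - p (z.1 - v) | z in G].
have S_ub w : G w -> ubound S (p (w.1 + v) - w.2).
  move=> Gw _ [z Gz <-]; have := Gd _ (Gl 1 _ _ Gz Gw); rewrite scale1r mul1r /=.
  have := p_subadd (z.1 - v) (w.1 + v); rewrite addrACA addNr addr0; lra.
have S0 : S !=set0 by exists (z0.2 - p (z0.1 - v)), z0.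
pose r := sup S.
have r_le w : G w -> w.2 + r <= p (w.1 + v).
  by move=> Gw; have := ge_sup S0 (S_ub w Gw); rewrite -/r; lra.
have r_ge w : G w -> w.2 - r <= p (w.1 - v).
  move=> Gw; have : S (w.2 - p (w.1 - v)) by exists w.
  move/(ub_le_sup (ex_intro _ _ (S_ub _ Gz0))); rewrite -/r; lra.
have G00 : G (0, 0).
  by have := graph_scale 0 Gl Gz0; rewrite scale0r mul0r.
exists [set x | exists z c, G z /\ x = (z.1 + c *: v, z.2 + c * r)]; split.
- by move=> z Gz; exists z, 0; split=> //; rewrite scale0r mul0r !addr0; case: z {Gz}.
- move=> c _ _ [z [a [Gz ->]]] [w [b [Gw ->]]] /=.
  exists (c *: z.1 + w.1, c * z.2 + w.2), (c * a + b); split; first exact: Gl.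
  rewrite /= scalerDr scalerDl scalerA mulrDr mulrDl -mulrA.
  by rewrite !(addrACA _ w.1) !(addrACA _ w.2).
- move=> _ [z [c [Gz ->]]] /=.
  have [c0|c0|->] := ltgtP c 0; last by rewrite scale0r mul0r !addr0; exact: Gd.
  + have nc0 : 0 < - c by rewrite oppr_gt0.
    have := r_ge _ (graph_scale (- c)^-1 Gl Gz).
    rewrite /= -(ler_pM2l nc0) -p_homog ?(ltW nc0)//.
    rewrite mulrBr scalerBr mulrA scalerA mulfV ?gt_eqF// mul1r scale1r.
    by rewrite scaleNr mulNr !opprK.
  + have := r_le _ (graph_scale c^-1 Gl Gz).
    rewrite /= -(ler_pM2l c0) -p_homog ?(ltW c0)//.
    by rewrite mulrDr scalerDr mulrA scalerA mulfV ?gt_eqF// mul1r scale1r.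
- by exists r, (0, 0), 1; rewrite scale1r mul1r !add0r.
Qed.

(** Zorn's lemma also asks for the union of the empty chain, so the empty graph
    is admitted beside those containing [G0]; a maximal graph is nonempty
    because [G0] lies above the empty one, and total because of
    [graph_extend]. *)
Theorem hahn_banach_graph G0 :
  G0 !=set0 -> linear_graph G0 -> dominated_graph G0 ->
  exists g : V -> R, [/\ linear (g : V -> R^o), forall v, g v <= p v &
    forall z, G0 z -> g z.1 = z.2].
Proof.
move=> G0n G0l G0d.
pose P G := [/\ linear_graph G, dominated_graph G & G !=set0 -> G0 `<=` G].
have [F FP Ftot|G [[Gl Gd GG0] Gmax]] := @Zorn_bigcup (V * R)%type P.
  split.
  - move=> c z w [A FA Az] [B FB Bw].
    case: (Ftot A B FA FB) => AB.
      by exists B => //; case: (FP _ FB) => Bl _ _; apply: Bl => //; exact: AB.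
    by exists A => //; case: (FP _ FA) => Al _ _; apply: Al => //; exact: AB.
  - by move=> z [A FA Az]; case: (FP _ FA) => _ Ad _; exact: Ad.
  - move=> [z [A FA Az]] w G0w; exists A => //.
    by case: (FP _ FA) => _ _; apply=> //; exists z.
have Gn : G !=set0.
  have [G_0|/set0P//] := eqVneq G set0.
  exfalso; apply: (Gmax G0); last by split=> // _; exact: subset_refl.
  by split; [rewrite G_0; exact: sub0set|rewrite G_0 => G0_0; case: G0n => z /G0_0].
have Gtot v : exists r, G (v, r).
  have [H [GH Hl Hd [r Hvr]]] := graph_extend v Gn Gl Gd.
  have [->|GneH] := pselect (G = H); first by exists r.
  exfalso; apply: (Gmax H); first by rewrite properEneq; split=> //; apply/eqP.
  by split=> // _; apply: subset_trans GH; exact: GG0.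
pose g v := projT1 (cid (Gtot v)).
have gP v : G (v, g v) by rewrite /g; case: cid.
exists g; split=> [c u v|v|z G0z].
- apply: (graph_functional Gl Gd (gP _)).
  exact: (Gl c (u, g u) (v, g v)).
- exact: (Gd _ (gP v)).
- by apply: (graph_functional Gl Gd (gP _)); case: z G0z => v r; exact: GG0.
Qed.

(** Extend [c *: e |-> c * p e] from the line through [e]. *)
Corollary hahn_banach_support e :
  exists g : V -> R, [/\ linear (g : V -> R^o), forall v, g v <= p v & g e = p e].
Proof.
pose L := [set (c *: e, c * p e) | c in @setT R].
have [||_ [c _ <-] /=|g [gl gp gL]] := @hahn_banach_graph L.
- by exists (0 *: e, 0 * p e), 0.
- move=> c _ _ [a _ <-] [b _ <-]; exists (c * a + b) => //=.
  by rewrite scalerDl scalerA mulrDl mulrA.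
- have [c0|c0] := lerP 0 c; first by rewrite p_homog.
  (* For c < 0: 0 = p 0 <= p (c *: e) + p (- c *: e) = p (c *: e) - c * p e. *)
  have nc0 : 0 <= - c by rewrite oppr_ge0 ltW.
  have := p_subadd (c *: e) (- c *: e).
  rewrite -scalerDl subrr (@p_homog 0)// mul0r (@p_homog (- c))//.
  by rewrite mulNr subr_ge0.
- exists g; split=> //; have /= := gL (e, p e); apply.
  by exists 1; rewrite // scale1r mul1r.
Qed.

End hahn_banach.

(** * Norming functionals over both scalar fields *)

Section linear_functional.
Context {K : numFieldType} {V : lmodType K} {f : V -> K^o}.
Hypothesis f_linear : linear f.

Lemma linear_functionalZ c v : f (c *: v) = c * f v.
Proof.
have f0 : f 0 = 0.
  by have := f_linear (-1) 0 0; rewrite scaler0 addr0 scaleN1r addNr.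
by have := f_linear c v 0; rewrite !addr0 f0 addr0.
Qed.

Lemma linear_functionalD u v : f (u + v) = f u + f v.
Proof. by have := f_linear 1 u v; rewrite !scale1r. Qed.

End linear_functional.

(** A copy of [V] on which to declare the real module structure, so that it does
    not compete with the complex one. *)
Definition realification (R : rcfType) (V : lmodType R[i]) : Type := V.

Section realification.
Context {R : rcfType} {V : lmodType R[i]}.

HB.instance Definition _ := GRing.Zmodule.on (realification V).

Definition real_scale (c : R) (v : realification V) : realification V :=
  (c%:C)%C *: (v : V).

Lemma real_scaleA a b v : real_scale a (real_scale b v) = real_scale (a * b) v.
Proof. by rewrite /real_scale scalerA -rmorphM. Qed.

Lemma real_scale1 : left_id 1 real_scale.
Proof. by move=> v; rewrite /real_scale rmorph1 scale1r. Qed.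

Lemma real_scaleDr : right_distributive real_scale +%R.
Proof. by move=> c u v; rewrite /real_scale scalerDr. Qed.

Lemma real_scaleDl v : {morph real_scale^~ v : a b / a + b}.
Proof. by move=> a b; rewrite /real_scale rmorphD scalerDl. Qed.

HB.instance Definition _ := GRing.Zmodule_isLmodule.Build R (realification V)
  real_scaleA real_scale1 real_scaleDr real_scaleDl.

(** The only possible complex-linear map with real part [g]. *)
Definition complex_functional (g : realification V -> R) (v : V) : R[i] :=
  (g v +i* - g ('i *: v))%C.

Variable g : realification V -> R.
Hypothesis g_linear : linear (g : realification V -> R^o).

Lemma complex_functional_linear : linear (complex_functional g : V -> R[i]^o).
Proof.
have gD (u v : V) : g (u + v) = g u + g v.
  exact: linear_functionalD g_linear u v.
have gZ a u : g ((a%:C)%C *: u) = a * g u.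
  exact: linear_functionalZ g_linear a u.
move=> [a b] u v; rewrite /complex_functional.
have cE w : (a +i* b)%C *: w = (a%:C)%C *: w + (b%:C)%C *: ('i%C *: w) :> V.
  by rewrite scalerA -scalerDl; congr (_ *: _); simpc.
have iiE w : 'i%C *: ('i%C *: w) = ((-1)%:C)%C *: w :> V.
  by rewrite scalerA; congr (_ *: _); simpc.
rewrite -complexiE scalerDr !scalerA ['i%C * _]mulrC -!scalerA !cE iiE !gD !gZ.
rewrite /GRing.scale /=; simpc.
by apply/eqP; rewrite eq_complex /=; apply/andP; split; apply/eqP; lra.
Qed.

(** Rotating [v] by a suitable unit scalar makes the value of the functional real
    and nonnegative, hence equal to the value of its real part [g]. *)
Lemma complex_functional_le (p : V -> R) :
  (forall c v, `|c| = 1 -> p (c *: v) = p v) ->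
  (forall v, g v <= p v) -> forall v, complex.Re `|complex_functional g v| <= p v.
Proof.
move=> pZ gp v; set z := complex_functional g v.
have [u u1 uz] : exists2 u : R[i], `|u| = 1 & u * z = `|z|.
  have [z0|z0] := eqVneq z 0.
    by exists 1; rewrite ?normr1// z0 mulr0 normr0.
  have nz0 : `|z| != 0 by rewrite normr_eq0.
  exists (z^*%C / `|z|).
    by rewrite normrM normrV ?unitfE// normr_id normcJ mulfV.
  by rewrite mulrAC [_ * z]mulrC -sqr_normc expr2 mulfK.
rewrite -uz -(linear_functionalZ complex_functional_linear).
rewrite -(pZ u v u1); exact: gp.
Qed.
End realification.

Section norming_functional.
Context {R : realType} {k : scalar_kind}.
Notation K := (scalars R k).

Lemma bounded_linear_dual (E : normedModType K) (f : E -> K^o) (M : R) :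
  linear f -> (forall v, rnorm (f v) <= M * rnorm v) -> f \in @dual_pred R k E.
Proof.
move=> fl fM; rewrite inE; split=> //.
pose F : {linear E -> K^o} := HB.pack f (GRing.isLinear.Build _ _ _ _ _ fl).
apply: (@linear_bounded_continuous _ _ _ F).1.
have M_real : scalar_inj R k M \is Num.real.
  by rewrite realE -(@scalar_inj0 R k) !scalar_inj_le; exact: le_total.
apply/linear_boundedP; near=> r => v.
have rM : scalar_inj R k M <= r by near: r; exact: nbhs_pinfty_ge.
apply: le_trans (ler_wpM2r (normr_ge0 _) rM).
by rewrite -[`|v|]rnormE -scalar_injM -[leLHS]rnormE scalar_inj_le; exact: fM.
Unshelve. all: by end_near.
Qed.

(** Apply [hahn_banach_support] to the norm; over the complex numbers
    [|g e| <= |complex_functional g e|] because [g] is the real part. *)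
Lemma norming_functional (E : normedModType K) (e : E) :
  exists phi : top_dual E, op_norm phi <= 1 /\ rnorm (phi e) = rnorm e.
Proof.
suff [f [fl f_le fe]] : exists f : E -> K^o,
    [/\ linear f, forall v, rnorm (f v) <= rnorm v & rnorm e <= rnorm (f e)].
  have fdual : f \in @dual_pred R k E.
    by apply: (@bounded_linear_dual _ _ 1) => // v; rewrite mul1r.
  exists (Dual fdual); split; last by apply/le_anti; rewrite f_le fe.
  by apply: op_norm_le => v; apply: le_trans; exact: f_le.
case: k E e => E e.
- have [|c u c0|g [gl gle ge]] :=
    @hahn_banach_support R E (@rnorm R real_scalars E) _ _ e.
  + exact: rnorm_triangle.
  + by rewrite rnormZ /sabs ger0_norm.
  + exists g; split=> // [v|].
    * rewrite ler_norml gle andbT lerNl -mulN1r.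
      rewrite -(linear_functionalZ gl) scaleN1r -[leRHS]normrN; exact: gle.
    * by rewrite -ge; exact: ler_norm.
- have [|c u c0|g [gl gle ge]] := @hahn_banach_support R (realification E)
    (@rnorm R complex_scalars E) _ _ e.
  + exact: rnorm_triangle.
  + by rewrite [LHS]rnormZ (@sabs_inj R complex_scalars).
  + exists (complex_functional g); split.
    * exact: complex_functional_linear.
    * apply: complex_functional_le => // c v c1.
      by rewrite rnormZ /sabs c1 mul1r.
    * rewrite -ge -(@scalar_inj_le R complex_scalars) rnormE.
      apply: le_trans (normc_ge_Re _).
      rewrite lecR; exact: ler_norm.
Qed.

End norming_functional.

(** * Absolute values of real scalars *)

Section scalars_complements.
Context {R : realType} {k : scalar_kind}.

Lemma scalar_injB (x y : R) :
  scalar_inj R k (x - y) = scalar_inj R k x - scalar_inj R k y.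
Proof. by case: k => //=; rewrite rmorphB. Qed.

Lemma sabs_injE (x : R) : sabs (scalar_inj R k x) = `|x|.
Proof.
have [x0|x0] := leP 0 x; first by rewrite sabs_inj// ger0_norm.
have Nx0 : 0 <= - x by rewrite oppr_ge0 ltW.
rewrite ltr0_norm// -[RHS](@sabs_inj R k)// -[in RHS](sub0r x) scalar_injB.
by rewrite scalar_inj0 sub0r /sabs normrN.
Qed.

Lemma sabs0 : sabs (0 : scalars R k) = 0.
Proof. by rewrite -scalar_inj0 sabs_inj. Qed.

End scalars_complements.

(** * The Lipschitz projective norm *)

Section projective_norm.
Context {R : realType} {k : scalar_kind}.
Notation K := (scalars R k).
Context {X : pointedMetricType R} {E : completeNormedModType K}.
Implicit Types (u v : lip_tensor X E) (r s : R).

Definition rep_costs u : set R :=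
  [set r | exists (n : nat) (x y : 'I_n -> X) (e : 'I_n -> E),
     u = \sum_(i < n) box (x i) (y i) (e i) /\
     r = \sum_(i < n) mdist (x i) (y i) * rnorm (e i)]%classic.

Lemma box_scale (c : K) x y e :
  c *: box x y e = box x y (c *: e) :> lip_tensor X E.
Proof.
apply/val_inj/val_inj/funext => f.
by rewrite /= /box_fun (linear_functionalZ (@dual_linear _ _ _ _)).
Qed.

Lemma rep_costs_ge0 u r : rep_costs u r -> 0 <= r.
Proof.
move=> [n [x [y [e [_ ->]]]]]; apply: sumr_ge0 => i _.
by rewrite mulr_ge0 ?mdist_ge0 ?rnorm_ge0.
Qed.

Lemma rep_costs0 : rep_costs 0 0.
Proof.
by exists 0%N, (fun=> point), (fun=> point), (fun=> 0); rewrite !big_ord0.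
Qed.

Lemma rep_costs_box x y e : rep_costs (box x y e) (mdist x y * rnorm e).
Proof.
by exists 1%N, (fun=> x), (fun=> y), (fun=> e); rewrite !big_ord_recl !big_ord0 !addr0.
Qed.

Definition cat_ord m n T (f : 'I_m -> T) (g : 'I_n -> T) (i : 'I_(m + n)) : T :=
  match fintype.split i with inl a => f a | inr b => g b end.

Lemma cat_ord_lshift m n T (f : 'I_m -> T) (g : 'I_n -> T) i :
  cat_ord f g (lshift n i) = f i.
Proof. by rewrite /cat_ord (unsplitK (inl i)). Qed.

Lemma cat_ord_rshift m n T (f : 'I_m -> T) (g : 'I_n -> T) i :
  cat_ord f g (rshift m i) = g i.
Proof. by rewrite /cat_ord (unsplitK (inr i)). Qed.

Lemma rep_costsD u v r s :
  rep_costs u r -> rep_costs v s -> rep_costs (u + v) (r + s).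
Proof.
move=> [m [x [y [e [-> ->]]]]] [n [x' [y' [e' [-> ->]]]]].
exists (m + n)%N, (cat_ord x x'), (cat_ord y y'), (cat_ord e e').
by rewrite !big_split_ord /=; split; congr (_ + _); apply: eq_bigr => i _;
  rewrite ?cat_ord_lshift ?cat_ord_rshift.
Qed.

Lemma rep_costsZ (c : K) u r : rep_costs u r -> rep_costs (c *: u) (sabs c * r).
Proof.
move=> [n [x [y [e [-> ->]]]]]; exists n, x, y, (fun i => c *: e i).
rewrite scaler_sumr mulr_sumr; split; apply: eq_bigr => i _.
  exact: box_scale.
by rewrite rnormZ mulrCA.
Qed.

(** An element of the span is a linear combination of boxes, whose coefficients
    are absorbed into the vectors by [box_scale]; without this lemma the infimum
    could be the default value at the empty set. *)
Lemma rep_costs_neq0 u : (rep_costs u !=set0)%classic.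
Proof.
have [s [sB uE]] : exists s : seq (K * alg_dual (lip0 X (top_dual E))),
    (forall p, p \in s -> boxes p.2) /\ val u = \sum_(p <- s) p.1 *: p.2.
  by have := valP u; rewrite inE.
suff [w wE wr] : exists2 w : lip_tensor X E,
    val w = \sum_(p <- s) p.1 *: p.2 & (rep_costs w !=set0)%classic.
  by have -> : u = w by apply: val_inj; rewrite /= uE -wE.
elim: s sB {u uE} => [_|[c b] s IH sB].
  by exists 0; [rewrite big_nil|exists 0; exact: rep_costs0].
have [p ps|w wE [r wr]] := IH; first by apply: sB; rewrite inE ps orbT.
have [x [y [e /= bE]]] := sB _ (mem_head _ _).
exists (c *: box x y e + w); first by rewrite big_cons -wE bE.
exists (sabs c * (mdist x y * rnorm e) + r).
exact: rep_costsD (rep_costsZ _ (rep_costs_box _ _ _)) wr.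
Qed.

Lemma lip_proj_norm_le u r : rep_costs u r -> lip_proj_norm u <= r.
Proof. by move=> ur; apply: ge_inf => //; exists 0 => s; exact: rep_costs_ge0. Qed.

Lemma le_lip_proj_norm u r :
  (forall s, rep_costs u s -> r <= s) -> r <= lip_proj_norm u.
Proof. by move=> h; apply: lb_le_inf => //; exact: rep_costs_neq0. Qed.

Lemma lip_proj_normD u v :
  lip_proj_norm (u + v) <= lip_proj_norm u + lip_proj_norm v.
Proof.
rewrite -lerBlDr; apply: le_lip_proj_norm => r ur.
rewrite lerBlDr -lerBlDl; apply: le_lip_proj_norm => s vs.
by rewrite lerBlDl; exact: lip_proj_norm_le (rep_costsD ur vs).
Qed.

Lemma lip_proj_normZ (c : K) u :
  lip_proj_norm (c *: u) = sabs c * lip_proj_norm u.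
Proof.
have [->|c0] := eqVneq c 0.
  rewrite scale0r sabs0 mul0r; apply/le_anti/andP; split.
    exact: lip_proj_norm_le rep_costs0.
  by apply: le_lip_proj_norm => s; exact: rep_costs_ge0.
have sabs_gt0 (d : K) : d != 0 -> 0 < sabs d.
  move=> d0; rewrite lt_neqAle sabs_ge0 andbT eq_sym.
  by apply: contra_neq d0; exact: sabs_eq0.
have le (d : K) (w : lip_tensor X E) :
    d != 0 -> lip_proj_norm (d *: w) <= sabs d * lip_proj_norm w.
  move=> d0; rewrite mulrC -ler_pdivrMr ?sabs_gt0//.
  apply: le_lip_proj_norm => r wr; rewrite ler_pdivrMr ?sabs_gt0// mulrC.
  exact: lip_proj_norm_le (rep_costsZ d wr).
apply/le_anti; rewrite le//=.
have := le c^-1 (c *: u); rewrite invr_eq0 scalerA mulVf// scale1r => /(_ c0).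
by rewrite -(ler_pM2l (sabs_gt0 c c0)) mulrA -sabsM mulfV// sabs1 mul1r.
Qed.

Lemma lip_tensor_eval0 (f : lip0 X (top_dual E)) :
  val (0 : lip_tensor X E) f = 0.
Proof. by []. Qed.

Lemma lip_tensor_evalD u v (f : lip0 X (top_dual E)) :
  val (u + v) f = val u f + val v f.
Proof. by []. Qed.

Lemma lip_tensor_eval_box x y e (f : lip0 X (top_dual E)) :
  val (box x y e : lip_tensor X E) f = (f x - f y) e.
Proof. by []. Qed.

(** Each box of a representation contributes at most
    [|f x - f y| * |e| <= C * mdist x y * |e|]. *)
Lemma lip_eval_le u (f : lip0 X (top_dual E)) (C : R) : 0 < C ->
  (forall x y, rnorm (f x - f y) <= C * mdist x y) ->
  rnorm (val u f) <= C * lip_proj_norm u.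
Proof.
move=> C0 fC; rewrite mulrC -ler_pdivrMr//.
apply: le_lip_proj_norm => _ [n [x [y [e [-> ->]]]]].
rewrite ler_pdivrMr// mulrC mulr_sumr.
apply: (big_ind2 (fun (w : lip_tensor X E) t => rnorm (val w f) <= t)).
- by rewrite lip_tensor_eval0 (@rnorm0 R k K^o).
- move=> w t w' t' wt wt'; rewrite lip_tensor_evalD.
  by apply: le_trans (lerD wt wt'); exact: (@rnorm_triangle R k K^o).
- move=> i _; rewrite lip_tensor_eval_box; apply: le_trans (le_op_norm _ _) _.
  by rewrite mulrA ler_wpM2r ?rnorm_ge0// -rnorm_dualE.
Qed.

(** [lip_eval_le] at every [f] makes [u] the zero functional; the constant of [f]
    is enlarged to [`|C| + 1] only to make it positive. *)
Lemma lip_proj_norm_eq0 u : lip_proj_norm u = 0 -> u = 0.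
Proof.
move=> u0; apply/val_inj/val_inj/funext => f.
have /asboolP [[C fC] _] := valP f.
apply: (@rnorm0_eq0 R k K^o); apply/le_anti; rewrite rnorm_ge0 andbT.
have := @lip_eval_le u f (`|C| + 1); rewrite u0 mulr0; apply; first by rewrite ltr_wpDl.
move=> x y; apply: le_trans (fC x y) _; rewrite ler_wpM2r ?mdist_ge0//.
by rewrite (le_trans (ler_norm C))// lerDl.
Qed.

(** Subtracting [mdist point y] makes the map vanish at the base point without
    changing its increments. *)
Definition dist_functional (y : X) (phi : top_dual E) (z : X) : top_dual E :=
  scalar_inj R k (mdist z y - mdist point y) *: phi.

Lemma dist_functionalB y phi z w : dist_functional y phi z - dist_functional y phi w =
  scalar_inj R k (mdist z y - mdist w y) *: phi.
Proof.
rewrite /dist_functional -scalerBl -scalar_injB; congr (scalar_inj R k _ *: _).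
by lra.
Qed.

(** The distance to [y] is 1-Lipschitz. *)
Lemma dist_functional_lip y phi z w : op_norm phi <= 1 ->
  rnorm (dist_functional y phi z - dist_functional y phi w) <= mdist z w.
Proof.
move=> phi1; rewrite dist_functionalB rnormZ sabs_injE rnorm_dualE.
apply: le_trans (ler_piMr (normr_ge0 _) phi1) _.
rewrite ler_norml; have := metric_triangle z w y; have := metric_triangle w z y.
by rewrite (metric_sym w z); lra.
Qed.

(** Evaluating [box x y e] at [dist_functional y phi], where [phi] norms [e],
    attains the upper bound given by the one-term representation. *)
Lemma lip_proj_norm_box x y e :
  lip_proj_norm (box x y e : lip_tensor X E) = mdist x y * rnorm e.
Proof.
apply/le_anti; rewrite lip_proj_norm_le/=; last exact: rep_costs_box.
have [phi [phi1 phie]] := norming_functional e.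
have f_lip0 : dist_functional y phi \in @lip0_pred R k X (top_dual E).
  apply/asboolP; split.
    by exists 1 => z w; rewrite mul1r; exact: dist_functional_lip.
  by rewrite /dist_functional subrr scalar_inj0 scale0r.
pose f := Lip0 f_lip0.
have fB : f x - f y = scalar_inj R k (mdist x y) *: phi.
  by rewrite [LHS]dist_functionalB mdistxx subr0.
have -> : mdist x y * rnorm e = rnorm ((f x - f y) e).
  rewrite fB [RHS](@rnormZ R k K^o) phie sabs_injE ger0_norm//.
  exact: mdist_ge0.
rewrite -lip_tensor_eval_box -[leRHS]mul1r; apply: lip_eval_le => // z w.
by rewrite mul1r; exact: dist_functional_lip.
Qed.

(** The norm of a sum of boxes is at most the sum of their norms, which for a
    cross-norm is the cost of the representation. *)
Lemma cross_norm_le_proj (alpha : lip_tensor X E -> R) u :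
  lip_cross_norm alpha -> alpha u <= lip_proj_norm u.
Proof.
move=> [[_ _ aZ aD] a_box]; apply: le_lip_proj_norm => _ [n [x [y [e [-> ->]]]]].
apply: (big_ind2 (fun w t => alpha w <= t)).
- by rewrite -(scale0r (0 : lip_tensor X E)) aZ sabs0 mul0r.
- by move=> w t w' t' wt wt'; apply: le_trans (lerD wt wt'); exact: aD.
- by move=> i _; rewrite a_box.
Qed.

End projective_norm.

Theorem theorem6p4 (R : realType) (k : scalar_kind) (X : pointedMetricType R)
    (E : completeNormedModType (scalars R k)) :
  lip_cross_norm (@lip_proj_norm R k X E) /\
  (forall alpha : lip_tensor X E -> R, lip_cross_norm alpha ->
     forall u : lip_tensor X E, alpha u <= lip_proj_norm u).
Proof.
split=> [|alpha alphaP u]; last exact: cross_norm_le_proj.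
split; last exact: lip_proj_norm_box.
split.
- by move=> u; apply: le_lip_proj_norm => r; exact: rep_costs_ge0.
- exact: lip_proj_norm_eq0.
- exact: lip_proj_normZ.
- exact: lip_proj_normD.
Qed.
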